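(* Let $\mathbb{H}$ be a real or complex Hilbert space, let $A\in\mathbb{B}(\mathbb{H})$ be a nonzero positive operator, and let $T\in\mathbb{B}_{A^{1/2}}(\mathbb{H})$ satisfy $\|T\|_A\neq 0$. For $S\in\mathbb{B}_{A^{1/2}}(\mathbb{H})$ let $W_A(T,S)$ be the set of all scalars $\sigma$ for which there exists a sequence $\{x_n\}\subset\mathbb{H}$ with $\|x_n\|_A=1$ for all $n$, $\|Tx_n\|_A\to\|T\|_A$ and $\langle Tx_n,Sx_n\rangle_A\to\sigma$. Then $T$ is $A$-smooth if and only if $W_A(T,S)$ is a singleton for every $S\in\mathbb{B}_{A^{1/2}}(\mathbb{H})$.
   Context: $\mathbb{B}(\mathbb{H})$ is the set of bounded linear operators on the Hilbert space $(\mathbb{H},\langle\cdot,\cdot\rangle)$. A positive operator $A$ is a self-adjoint operator with $\langle Ax,x\rangle\ge 0$ for all $x$. It induces the semi-inner product $\langle x,y\rangle_A=\langle Ax,y\rangle$ and the semi-norm $\|x\|_A=\sqrt{\langle x,x\rangle_A}=\|A^{1/2}x\|$. $\mathbb{B}_{A^{1/2}}(\mathbb{H})$ is the set of $A$-bounded operators, i.e. those $T\in\mathbb{B}(\mathbb{H})$ for which there is $c>0$ with $\|Tx\|_A\le c\|x\|_A$ for all $x\in\mathbb{H}$; for such $T$, $\|T\|_A=\sup\{\|Tx\|_A:\|x\|_A=1\}$. For $T,S\in\mathbb{B}_{A^{1/2}}(\mathbb{H})$, $T\perp_A^B S$ ($A$-Birkhoff–James orthogonality) means $\|T+\lambda S\|_A\ge\|T\|_A$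 for all scalars $\lambda$. An operator $T\in\mathbb{B}_{A^{1/2}}(\mathbb{H})$ with $\|T\|_A\neq 0$ is called $A$-smooth if for all $S_1,S_2\in\mathbb{B}_{A^{1/2}}(\mathbb{H})$, $T\perp_A^B S_1$ and $T\perp_A^B S_2$ imply $T\perp_A^B S_1+S_2$. *)

(* Defs.v *)
From HB Require Import structures.
From mathcomp Require Import all_boot all_order all_algebra.
From mathcomp Require Import complex.
From mathcomp Require Import boolp classical_sets reals topology normedtype.

Set Implicit Arguments.
Unset Strict Implicit.
Unset Printing Implicit Defensive.

Import Order.TTheory GRing.Theory Num.Theory.
Import numFieldNormedType.Exports.

Local Open Scope classical_set_scope.
Local Open Scope ring_scope.

Variant scalar_kind := RealScalars | ComplexScalars.

Definition scalars (R : realType) (k : scalar_kind) : numFieldType :=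
  match k with RealScalars => R | ComplexScalars => R[i]%C end.

Definition scalar_conj (R : realType) (k : scalar_kind) :
    involutive_rmorphism (scalars R k) :=
  match k with RealScalars => idfun | ComplexScalars => Num.conj end.

Definition scalar_re (R : realType) (k : scalar_kind) : scalars R k -> R :=
  match k with RealScalars => idfun | ComplexScalars => @complex.Re R end.

(* [{dot H for theta}] is linear in its first argument and theta-semilinear in
   its second one. *)
HB.mixin Record CompleteNormedModule_isHilbert (R : realType) (k : scalar_kind)
    H of CompleteNormedModule (scalars R k) H := {
  inner : {dot H for scalar_conj R k} ;
  innerxx : forall x : H, inner x x = `|x| ^+ 2
}.

#[short(type="hilbertType")]
HB.structure Definition Hilbert (R : realType) (k : scalar_kind) :=
  { H of CompleteNormedModule (scalars R k) H
       & CompleteNormedModule_isHilbert R k H }.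

Definition bounded_op (R : realType) (k : scalar_kind) (H : hilbertType R k)
    (T : {linear H -> H}) : Prop :=
  exists c : scalars R k, forall x, `|T x| <= c * `|x|.

(* For complex scalars, [0 <= z] in [R[i]] says that [z] is real and
   nonnegative. *)
Definition positive_op (R : realType) (k : scalar_kind) (H : hilbertType R k)
    (A : {linear H -> H}) : Prop :=
  (forall x y, inner (A x) y = inner x (A y)) /\
  (forall x, 0 <= inner (A x) x).

Definition innerA (R : realType) (k : scalar_kind) (H : hilbertType R k)
    (A : {linear H -> H}) (x y : H) : scalars R k := inner (A x) y.

(* When A is positive, [innerA A x x] is real, and [scalar_re] only changes its
   type. *)
Definition seminormA (R : realType) (k : scalar_kind) (H : hilbertType R k)
    (A : {linear H -> H}) (x : H) : R :=
  Num.sqrt (scalar_re (innerA A x x)).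

Definition bounded_opA (R : realType) (k : scalar_kind) (H : hilbertType R k)
    (A T : {linear H -> H}) : Prop :=
  bounded_op T /\
  exists2 c : R, 0 < c & forall x, seminormA A (T x) <= c * seminormA A x.

(* [sup] is the supremum as soon as the set is nonempty and bounded above, i.e.
   if A is nonzero and positive and T is A-bounded. *)
Definition opnormA (R : realType) (k : scalar_kind) (H : hilbertType R k)
    (A : {linear H -> H}) (T : H -> H) : R :=
  sup [set seminormA A (T x) | x in [set x | seminormA A x = 1]].

Definition BJorthA (R : realType) (k : scalar_kind) (H : hilbertType R k)
    (A : {linear H -> H}) (T S : H -> H) : Prop :=
  forall lambda : scalars R k,
    opnormA A T <= opnormA A (T \+ (lambda \*: S)).

Definition smoothA (R : realType) (k : scalar_kind) (H : hilbertType R k)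
    (A T : {linear H -> H}) : Prop :=
  [/\ bounded_opA A T, opnormA A T != 0 &
      forall S1 S2 : {linear H -> H}, bounded_opA A S1 -> bounded_opA A S2 ->
        BJorthA A T S1 -> BJorthA A T S2 -> BJorthA A T (S1 \+ S2)].

Definition WA (R : realType) (k : scalar_kind) (H : hilbertType R k)
    (A T S : {linear H -> H}) : set (scalars R k) :=
  [set sigma | exists x : nat -> H,
    [/\ forall n, seminormA A (x n) = 1,
        seminormA A (T (x n)) @[n --> \oo] --> opnormA A T &
        innerA A (T (x n)) (S (x n)) @[n --> \oo] --> sigma]].

(* Main.v *)
Require Import Defs.
From HB Require Import structures.
From mathcomp Require Import all_boot all_order all_algebra.
From mathcomp Require Import complex.
From mathcomp Require Import boolp classical_sets reals topology normedtype.
From mathcomp Require Import sequences realfun ring lra.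

Set Implicit Arguments.
Unset Strict Implicit.
Unset Printing Implicit Defensive.

Import Order.TTheory GRing.Theory Num.Theory.
Import numFieldNormedType.Exports.

Local Open Scope classical_set_scope.
Local Open Scope ring_scope.

(** Write N for the A-norm of T, and call a sequence of A-unit vectors x_n
    norming when the A-norms of T x_n tend to N.  Everything rests on the
    expansion
      ||T x + l S x||^2 = ||T x||^2 + 2 Re (l^* <T x, S x>) + |l|^2 ||S x||^2
    in the A-semi-norm ([innerA_sqD]), read along a norming sequence.

    If 0 belongs to W(T, S), the expansion along the corresponding norming
    sequence gives ||T + l S|| >= N for every l, so T is orthogonal to S
    ([BJorthA_of_WA0]).  Conversely, let T be orthogonal to S and fix a
    direction mu.  Nearly maximizing vectors of T + t mu S, for t = 1/(n+1),
    form a norming sequence of T, and a limit point of <T x_n, S x_n> along it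
    is an element s of W(T, S) with Re (mu^* s) >= 0 ([WA_half_plane]).  When
    W(T, S) = {s0}, the choice mu = - s0 forces s0 = 0
    ([WA0_of_BJorthA]).

    Smooth implies singleton.  W(T, S) is nonempty because a norming sequence
    exists and bounded scalar sequences have convergent subsequences.  If s1
    and s2 lie in W(T, S), then 0 lies in W(T, S - c_i T) for c_i = (s_i /
    N^2)^*, so T is orthogonal to S - c_1 T and to - (S - c_2 T); smoothness
    makes it orthogonal to (c_2 - c_1) T, which is absurd unless c_1 = c_2
    ([smoothA_WA_unique]).

    Singleton implies smooth.  If T is orthogonal to S1 and S2, then
    W(T, S1) = W(T, S2) = {0}.  A norming sequence realizing 0 for S1 has a
    subsequence along which <T x_n, S2 x_n> converges, necessarily to 0, and
    this subsequence puts 0 in W(T, S1 + S2). *)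

(** * Convergence of complex sequences and of subsequences *)

Lemma cvg_complexP (R : realType) (z : nat -> scalars R ComplexScalars)
    (s : scalars R ComplexScalars) :
  z n @[n --> \oo] --> s <->
  (complex.Re (z n) @[n --> \oo] --> complex.Re s /\
   complex.Im (z n) @[n --> \oo] --> complex.Im s).
Proof.
have normE (w : R[i]) :
    `|w| = (Num.sqrt (complex.Re w ^+ 2 + complex.Im w ^+ 2))%:C%C.
  exact: normc_def.
have leRe (w : R[i]) : (`|complex.Re w|%:C <= `|w|)%C.
  by rewrite normE lecR -sqrtr_sqr ler_wsqrtr // lerDl sqr_ge0.
have leIm (w : R[i]) : (`|complex.Im w|%:C <= `|w|)%C.
  by rewrite normE lecR -sqrtr_sqr ler_wsqrtr // lerDr sqr_ge0.
have le_norm (w : R[i]) :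
    (`|w| <= (`|complex.Re w| + `|complex.Im w|)%:C)%C.
  rewrite normE lecR -[leRHS]ger0_norm ?addr_ge0// -sqrtr_sqr ler_wsqrtr //.
  rewrite sqrrD !real_normK ?num_real//.
  by rewrite lerD2r lerDl mulrn_wge0 // mulr_ge0.
split=> [zs|[zre zim]].
  split; apply/cvgrPdist_lt => e e0.
    have e0' : 0 < (e%:C)%C :> R[i] by rewrite ltcR.
    have /cvgrPdist_lt/(_ _ e0') := zs; apply: filterS => n zn.
    rewrite -ltcR; apply: le_lt_trans zn.
    by apply: le_trans (leRe _); case: (z n) (s) => a b [c d].
  have e0' : 0 < (e%:C)%C :> R[i] by rewrite ltcR.
  have /cvgrPdist_lt/(_ _ e0') := zs; apply: filterS => n zn.
  rewrite -ltcR; apply: le_lt_trans zn.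
  by apply: le_trans (leIm _); case: (z n) (s) => a b [c d].
apply/cvgrPdist_lt => -[e e'] /=; rewrite ltcE /= => /andP[/eqP -> e0].
have e20 : 0 < e / 2 by rewrite divr_gt0.
have /cvgrPdist_lt/(_ _ e20) := zre; have /cvgrPdist_lt/(_ _ e20) := zim.
apply: filterS2 => n zimn zren; apply: le_lt_trans (le_norm _) _.
rewrite -[X in _ < X]/(e%:C)%C ltcR [e]splitr addrC.
by move: zimn zren; case: (z n) (s) => a b [c d] /=; exact: ltrD.
Qed.

Lemma increasing_seq_cvgoo (f : nat -> nat) :
  increasing_seq f -> f n @[n --> \oo] --> \oo.
Proof.
move=> f_incr; have lef n : (n <= f n)%N.
  elim: n => // n IH; apply: leq_ltn_trans IH _.
  by rewrite ltnNge -[(_ <= _)%N]/(f n.+1 <= f n)%O f_incr -ltnNge.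
move=> A [N _ NA]; exists N => // n /= Nn.
exact: NA (leq_trans Nn (lef n)).
Qed.

(** * Real and complex scalars, uniformly *)

Section Scalars.
Variables (R : realType) (k : scalar_kind).
Notation K := (scalars R k).
Notation re := (@scalar_re R k).
Notation cj := (scalar_conj R k).

Definition of_real : R -> K :=
  match k return R -> scalars R k with
  | RealScalars => id
  | ComplexScalars => real_complex R
  end.

(** The value 0 for real scalars makes [z |-> (re z, re (imag_unit * z))] a
    coordinate system for either kind of scalars: the second coordinate is
    constantly 0 over R and is - Im z over C. *)
Definition imag_unit : K :=
  match k return scalars R k with
  | RealScalars => 0
  | ComplexScalars => 'i%C
  end.

Lemma reD (z w : K) : re (z + w) = re z + re w.
Proof. by rewrite /scalar_re; case: k z w => //= -[a b] [c d]. Qed.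

Lemma reN (z : K) : re (- z) = - re z.
Proof. by rewrite /scalar_re; case: k z => //= -[a b]. Qed.

Lemma re_conj (z : K) : re (cj z) = re z.
Proof. by rewrite /scalar_re /scalar_conj; case: k z => //= -[a b]. Qed.

Lemma re_of_realM (r : R) (z : K) : re (of_real r * z) = r * re z.
Proof.
rewrite /scalar_re /of_real; case: k z => //= -[a b] /=.
by rewrite mul0r subr0.
Qed.

Lemma re_of_real (r : R) : re (of_real r) = r.
Proof. by rewrite /scalar_re /of_real; case: k. Qed.

Lemma of_real1 : of_real 1 = 1.
Proof. by rewrite /of_real; case: k. Qed.

Lemma re0 : re 0 = 0.
Proof. by rewrite /scalar_re; case: k. Qed.

Lemma of_real_eq0 (r : R) : (of_real r == 0) = (r == 0).
Proof.
rewrite /of_real; case: k => //=.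
by rewrite eq_complex /= eqxx andbT.
Qed.

Lemma conj_of_real (r : R) : cj (of_real r) = of_real r.
Proof.
rewrite /scalar_conj /of_real; case: k => //=.
exact: conjc_real.
Qed.

Lemma conj_fixed_real (z : K) : cj z = z -> z = of_real (re z).
Proof.
rewrite /scalar_re /scalar_conj /of_real; case: k z => //= -[a b] [] /= h.
by apply/eqP; rewrite eq_complex /= eqxx /=; apply/eqP; lra.
Qed.

Lemma of_realM (a b : R) : of_real (a * b) = of_real a * of_real b.
Proof. by rewrite /of_real; case: k => //; exact: rmorphM. Qed.

Lemma conjM (z w : K) : cj (z * w) = cj z * cj w.
Proof. exact: rmorphM. Qed.

Lemma conjK (z : K) : cj (cj z) = z.
Proof. exact: rmorphK. Qed.

Lemma mul_conj_real (z : K) : z * cj z = of_real (re (z * cj z)).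
Proof. by apply: conj_fixed_real; rewrite conjM conjK mulrC. Qed.

Lemma re_mul_conj_ge0 (z : K) : 0 <= re (z * cj z).
Proof.
rewrite /scalar_re /scalar_conj; case: k z => /=.
  by move=> z; rewrite -expr2 sqr_ge0.
by case=> a b /=; rewrite mulrN opprK addr_ge0 // -expr2 sqr_ge0.
Qed.

Lemma re_mul_conj_eq0 (z : K) : re (z * cj z) = 0 -> z = 0.
Proof.
rewrite /scalar_re /scalar_conj; case: k z => /=.
  by move=> z /eqP; rewrite mulf_eq0 orbb => /eqP.
case=> a b /= /eqP; rewrite mulrN opprK -!expr2 paddr_eq0 ?sqr_ge0 //.
by rewrite !sqrf_eq0 => /andP[/eqP-> /eqP->].
Qed.

Lemma re_ge0 (z : K) : 0 <= z -> 0 <= re z.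
Proof.
rewrite /scalar_re; case: k z => //= -[a b].
by rewrite lecE /= => /andP[].
Qed.

Lemma imag_unit_sq_le1 : re (cj imag_unit * imag_unit) <= 1.
Proof.
rewrite /scalar_re /scalar_conj /imag_unit; case: k => /=.
  by rewrite mul0r.
by rewrite ?mul0r ?mulr0; lra.
Qed.

Lemma cvg_scalarP (z : nat -> K) (s : K) :
  z n @[n --> \oo] --> s <->
  (re (z n) @[n --> \oo] --> re s /\
   re (imag_unit * z n) @[n --> \oo] --> re (imag_unit * s)).
Proof.
rewrite /scalar_re /imag_unit; case: k z s => /= z s.
  split=> [zs|[]//]; split => //.
  by under eq_fun do rewrite mul0r; rewrite mul0r; exact: cvg_cst.
rewrite (mulrC _ s) ReiNIm.
rewrite (_ : (fun n => complex.Re ('i%C * z n)) =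
             (fun n => - complex.Im (z n))); last first.
  by apply/funext => n; rewrite mulrC ReiNIm.
split=> [/cvg_complexP[? ?]|[? ?]]; first by split => //; exact: cvgN.
apply/cvg_complexP; split => //.
rewrite -[complex.Im s]opprK.
rewrite (_ : (fun n => complex.Im (z n)) = (fun n => - - complex.Im (z n))).
  exact: cvgN.
by apply/funext => n; rewrite opprK.
Qed.

Lemma cvg_scalar_re (w : K) (z : nat -> K) (s : K) :
  z n @[n --> \oo] --> s -> re (w * z n) @[n --> \oo] --> re (w * s).
Proof.
move=> zs; suff /cvg_scalarP[] : w * z n @[n --> \oo] --> w * s by [].
exact: cvgMr.
Qed.

Lemma cvg_of_real (z : nat -> R) (s : R) :
  z n @[n --> \oo] --> s -> of_real (z n) @[n --> \oo] --> of_real s.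
Proof.
move=> zs; apply/cvg_scalarP; rewrite re_of_real.
under eq_fun do rewrite re_of_real; split=> //.
rewrite mulrC re_of_realM; under eq_fun do rewrite mulrC re_of_realM.
exact: cvgMl.
Qed.

(** Bolzano-Weierstrass, one coordinate after the other. *)
Lemma bounded_scalar_subseq (z : nat -> K) (M : R) :
  (forall n, `|re (z n)| <= M /\ `|re (imag_unit * z n)| <= M) ->
  exists2 f : nat -> nat, increasing_seq f &
  exists s : K, z (f n) @[n --> \oo] --> s.
Proof.
move=> zM.
have bnd (u : nat -> R) : (forall n, `|u n| <= M) -> bounded_fun u.
  move=> uM; exists M; split; first exact: num_real.
  by move=> x Mx n _; exact: le_trans (uM n) (ltW Mx).
have [f f_incr /cvg_ex[a ua]] :=
  bolzano_weierstrass (bnd _ (fun n => (zM n).1)).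
have [g g_incr /cvg_ex[b ub]] :=
  bolzano_weierstrass (bnd _ (fun n => (zM (f n)).2)).
exists (f \o g); first by move=> n m; rewrite /= f_incr; exact: g_incr.
have {}ua : re (z (f (g n))) @[n --> \oo] --> a.
  exact: cvg_comp (increasing_seq_cvgoo g_incr) ua.
clear bnd zM; move: ua ub; rewrite /= /imag_unit /scalar_re /=.
case: k z => /= z ua ub; first by exists a.
exists (Complex a (- b)); apply/cvg_complexP; split=> //=.
rewrite (_ : (fun n => complex.Im _) =
             (fun n => - complex.Re ('i%C * z (f (g n))))).
  exact: cvgN ub.
by apply/funext => n; rewrite mulrC ReiNIm opprK.
Qed.

End Scalars.

(** * The semi-inner product induced by a positive operator *)

Section SemiInnerProduct.
Variables (R : realType) (k : scalar_kind) (H : hilbertType R k).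
Variables (A : {linear H -> H}) (posA : positive_op A).
Notation K := (scalars R k).
Notation re := (@scalar_re R k).
Notation cj := (scalar_conj R k).
Notation "''[' u , v ]" := (innerA A u v).
Notation q x := (re '[x, x]).

Lemma innerADl (u v w : H) : '[u + v, w] = '[u, w] + '[v, w].
Proof. by rewrite /innerA linearD linearDl. Qed.

Lemma innerADr (u v w : H) : '[u, v + w] = '[u, v] + '[u, w].
Proof. by rewrite /innerA linearDr. Qed.

Lemma innerAZl (a : K) (u v : H) : '[a *: u, v] = a * '[u, v].
Proof. by rewrite /innerA linearZ linearZl_LR. Qed.

Lemma innerAZr (a : K) (u v : H) : '[u, a *: v] = cj a * '[u, v].
Proof. by rewrite /innerA linearZr_LR. Qed.

Lemma innerAC (u v : H) : '[u, v] = cj '[v, u].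
Proof.
case: posA => symA _; rewrite /innerA symA.
by have := hermC inner u (A v); rewrite expr0 mul1r.
Qed.

Lemma innerAxx_ge0 (x : H) : 0 <= q x.
Proof. by apply: re_ge0; case: posA => _; exact. Qed.

Lemma innerAxx_real (x : H) : '[x, x] = of_real k (q x).
Proof. by apply: conj_fixed_real; rewrite -innerAC. Qed.

Lemma innerA_sqD (u v : H) (l : K) :
  q (u + l *: v) = q u + 2 * re (cj l * '[u, v]) + re (l * cj l) * q v.
Proof.
rewrite innerADl !innerADr !innerAZl !innerAZr !reD.
have -> : re (l * '[v, u]) = re (cj l * '[u, v]).
  by rewrite -re_conj conjM -innerAC.
rewrite mulrA mul_conj_real re_of_realM re_of_real; ring.
Qed.

Lemma seminormA_sq (x : H) : seminormA A x ^+ 2 = q x.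
Proof. by rewrite /seminormA sqr_sqrtr // innerAxx_ge0. Qed.

Lemma seminormA_ge0 (x : H) : 0 <= seminormA A x.
Proof. exact: sqrtr_ge0. Qed.

(** A substitute for the Cauchy-Schwarz inequality that avoids square roots:
    u + l v and u - l v both have nonnegative square. *)
Lemma re_innerA_le (u v : H) (l : K) :
  2 * `|re (cj l * '[u, v])| <= q u + re (l * cj l) * q v.
Proof.
have /= h1 := innerAxx_ge0 (u + l *: v).
have /= h2 := innerAxx_ge0 (u + (- l) *: v).
rewrite innerA_sqD in h1; rewrite innerA_sqD rmorphN mulrNN mulNr reN in h2.
case: (ger0P (re (cj l * '[u, v]))) => _; lra.
Qed.

(** * A-bounded maps and the A-operator semi-norm *)

(** A-boundedness in terms of squared semi-norms, for bare functions, so that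
    it applies to the maps occurring in [BJorthA]. *)
Definition semibounded (F : H -> H) :=
  exists2 c : R, 0 <= c & forall x, q (F x) <= c * q x.

Lemma bounded_opA_semibounded (T : {linear H -> H}) :
  bounded_opA A T -> semibounded T.
Proof.
case=> _ [c c0 cT]; exists (c ^+ 2); first exact: sqr_ge0.
move=> x; rewrite -!seminormA_sq -exprMn.
by rewrite ler_sqr ?nnegrE ?mulr_ge0 ?seminormA_ge0 // ltW.
Qed.

Lemma bounded_opA_of_semibounded (T : {linear H -> H}) :
  bounded_op T -> semibounded T -> bounded_opA A T.
Proof.
move=> bT [c c0 cT]; split=> //; exists (Num.sqrt c + 1).
  by rewrite ltr_wpDl ?sqrtr_ge0.
move=> x; apply: (@le_trans _ _ (Num.sqrt c * seminormA A x)).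
  by rewrite /seminormA -sqrtrM // ler_wsqrtr.
by rewrite ler_wpM2r ?seminormA_ge0 // lerDl.
Qed.

Lemma semiboundedZ (a : K) (F : H -> H) :
  semibounded F -> semibounded (a \*: F).
Proof.
move=> [c c0 cF]; have a0 := re_mul_conj_ge0 a.
exists (re (a * cj a) * c); first exact: mulr_ge0.
move=> x /=; rewrite innerAZl innerAZr mulrA mul_conj_real re_of_realM.
by rewrite re_of_real -mulrA ler_wpM2l.
Qed.

Lemma semiboundedD (F G : H -> H) (l : K) :
  semibounded F -> semibounded G -> semibounded (F \+ (l \*: G)).
Proof.
move=> [c c0 cF] [d d0 dG]; have l0 := re_mul_conj_ge0 l.
exists (2 * c + 2 * re (l * cj l) * d); first by rewrite addr_ge0 ?mulr_ge0.
move=> x /=; rewrite innerA_sqD.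
have := re_innerA_le (F x) (G x) l; have := cF x.
have := ler_wpM2l l0 (dG x).
have := ler_norm (re (cj l * '[F x, G x])).
by rewrite mulrDl -!mulrA; lra.
Qed.

Lemma semibounded_unit (F : H -> H) : semibounded F ->
  exists2 c, 0 <= c & forall x, seminormA A x = 1 -> q (F x) <= c.
Proof.
move=> [c c0 cF]; exists c => // x x1.
by apply: le_trans (cF x) _; rewrite -seminormA_sq x1 expr1n mulr1.
Qed.

Lemma seminormA_le_opnormA (F : H -> H) (x : H) :
  semibounded F -> seminormA A x = 1 -> seminormA A (F x) <= opnormA A F.
Proof.
move=> /semibounded_unit[c c0 cF] x1; apply: ub_le_sup; last by exists x.
exists (Num.sqrt c) => _ [y y1 <-].
by rewrite /seminormA ler_wsqrtr // cF.
Qed.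

(** Without A-unit vectors the norm would be the supremum of the empty set,
    that is 0. *)
Lemma unit_of_opnormA_neq0 (F : H -> H) :
  opnormA A F != 0 -> exists x, seminormA A x = 1.
Proof.
move=> F0; apply: contrapT => no_unit; move/eqP: F0; apply.
rewrite /opnormA (_ : [set _ | _ in _] = set0) ?sup0 //.
by apply/seteqP; split => // y [x x1 _]; apply: no_unit; exists x.
Qed.

Lemma opnormA_ge0 (F : H -> H) : semibounded F -> 0 <= opnormA A F.
Proof.
move=> bF; have [[x x1]|no_unit] := pselect (exists x, seminormA A x = 1).
  by apply: le_trans (seminormA_le_opnormA bF x1); exact: seminormA_ge0.
by have [->//|/unit_of_opnormA_neq0] := eqVneq (opnormA A F) 0.
Qed.

Lemma sq_le_opnormA (F : H -> H) (x : H) :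
  semibounded F -> seminormA A x = 1 -> q (F x) <= opnormA A F ^+ 2.
Proof.
move=> bF x1; rewrite -seminormA_sq ler_sqr ?nnegrE ?seminormA_ge0 //.
  exact: seminormA_le_opnormA.
exact: opnormA_ge0.
Qed.

Lemma opnormA_sq_approx (F : H -> H) (e : R) :
  semibounded F -> (exists x, seminormA A x = 1) -> 0 < e ->
  exists2 x, seminormA A x = 1 & opnormA A F ^+ 2 - e < q (F x).
Proof.
move=> bF [x0 x01] e0; apply: contrapT => noapprox.
have ub x : seminormA A x = 1 -> q (F x) <= opnormA A F ^+ 2 - e.
  by move=> x1; rewrite leNgt; apply/negP => lt; apply: noapprox; exists x.
have m0 := le_trans (innerAxx_ge0 _) (ub _ x01).
have : opnormA A F <= Num.sqrt (opnormA A F ^+ 2 - e).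
  apply: ge_sup; first by exists (seminormA A (F x0)), x0.
  by move=> _ [x x1 <-]; rewrite /seminormA ler_wsqrtr // ub.
rewrite -ler_sqr ?nnegrE ?sqrtr_ge0 ?opnormA_ge0 // sqr_sqrtr //.
by lra.
Qed.

Lemma cvg_seminormA_sq (u : nat -> H) (N : R) : 0 <= N ->
  seminormA A (u n) @[n --> \oo] --> N <-> q (u n) @[n --> \oo] --> N ^+ 2.
Proof.
move=> N0; split=> h.
  by under eq_fun do rewrite -seminormA_sq; exact: cvgM.
rewrite -[N]ger0_norm // -sqrtr_sqr.
exact: continuous_cvg (@sqrt_continuous R _) h.
Qed.

(** * Norming sequences and the set of limit values *)

Section Norming.
Variables (T S : {linear H -> H}).
Hypotheses (bT : semibounded T) (bS : semibounded S).

(** The scalars <T x_n, S x_n> are bounded on A-unit vectors, hence every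
    norming sequence produces elements of [WA A T S]. *)
Lemma WA_subseq (x : nat -> H) :
  (forall n, seminormA A (x n) = 1) ->
  seminormA A (T (x n)) @[n --> \oo] --> opnormA A T ->
  exists2 f : nat -> nat, increasing_seq f & exists2 s : K,
    WA A T S s & '[T (x (f n)), S (x (f n))] @[n --> \oo] --> s.
Proof.
move=> x1 xT.
have [c c0 cT] := semibounded_unit bT; have [d d0 dS] := semibounded_unit bS.
have bnd n : `|re '[T (x n), S (x n)]| <= c + d /\
    `|re (imag_unit R k * '[T (x n), S (x n)])| <= c + d.
  have le (l : K) : re (l * cj l) <= 1 ->
      `|re (cj l * '[T (x n), S (x n)])| <= c + d.
    move=> l1; have := re_innerA_le (T (x n)) (S (x n)) l.
    have := cT _ (x1 n); have := dS _ (x1 n).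
    have := innerAxx_ge0 (S (x n)); nra.
  split; last first.
    have := le (cj (imag_unit R k)); rewrite conjK; apply.
    exact: imag_unit_sq_le1.
  have re1 : re 1 = 1 by rewrite -(of_real1 R k) re_of_real.
  by have := le 1; rewrite rmorph1 !mul1r re1; apply.
have [f f_incr [s zs]] := bounded_scalar_subseq bnd.
exists f => //; exists s => //; exists (x \o f); split; last exact: zs.
  by move=> n; exact: (x1 (f n)).
exact: (cvg_comp _ _ (increasing_seq_cvgoo f_incr) xT).
Qed.

(** Along the norming sequence x_n, dropping |l|^2 ||S x_n||^2 from the
    expansion of ||(T + l S) x_n||^2 leaves a quantity that tends to N^2. *)
Lemma BJorthA_of_WA0 : WA A T S 0 -> BJorthA A T S.
Proof.
move=> [x [x1 xT xS]] l.
have bM := semiboundedD l bT bS.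
rewrite -ler_sqr ?nnegrE ?opnormA_ge0 //.
have cv : q (T (x n)) + 2 * re (cj l * '[T (x n), S (x n)]) @[n --> \oo] -->
    opnormA A T ^+ 2 + 2 * re (cj l * 0).
  apply: cvgD; last by apply: cvgMr; exact: cvg_scalar_re.
  by apply/cvg_seminormA_sq => //; exact: opnormA_ge0.
rewrite mulr0 re0 mulr0 addr0 in cv.
apply: (ler_cvg_to cv (cvg_cst _)); near=> n.
apply: le_trans (sq_le_opnormA bM (x1 n)).
rewrite /= innerA_sqD lerDl mulr_ge0 ?re_mul_conj_ge0 //.
exact: innerAxx_ge0.
Unshelve. all: by end_near. Qed.

(** First-order perturbation: if ||T + t mu S|| >= N for all t > 0, then
    almost maximizing vectors of T + t mu S also almost maximize T, and
    Re (mu^* <T x, S x>) is at least of order - t on them. *)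
Lemma WA_half_plane (mu : K) : (exists x, seminormA A x = 1) ->
  BJorthA A T S -> exists2 s, WA A T S s & 0 <= re (cj mu * s).
Proof.
move=> unit TS.
pose t n : R := n.+1%:R^-1.
have t0 n : 0 < t n by rewrite invr_gt0.
pose F n := T \+ ((of_real k (t n) * mu) \*: S).
have bF n : semibounded (F n) by exact: semiboundedD.
(* The tolerance t^2 is negligible against the first-order term in t. *)
have approx n : {x | seminormA A x = 1 /\
    opnormA A (F n) ^+ 2 - t n ^+ 2 < q (F n x)}.
  apply: cid.
  have [|x x1 xF] := @opnormA_sq_approx (F n) (t n ^+ 2) (bF n) unit.
    by rewrite exprn_gt0.
  by exists x.
pose x n := sval (approx n).
have x1 n : seminormA A (x n) = 1 by case: (svalP (approx n)).
have xF n : opnormA A (F n) ^+ 2 - t n ^+ 2 < q (F n (x n)).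
  by case: (svalP (approx n)).
have [c c0 cT] := semibounded_unit bT; have [d d0 dS] := semibounded_unit bS.
pose w n := re (cj mu * '[T (x n), S (x n)]).
pose m := re (mu * cj mu).
have m0 : 0 <= m by exact: re_mul_conj_ge0.
have key n : opnormA A T ^+ 2 <=
    q (T (x n)) + 2 * t n * w n + t n ^+ 2 * (1 + m * d).
  have NM : opnormA A T ^+ 2 <= opnormA A (F n) ^+ 2.
    by rewrite ler_sqr ?nnegrE ?opnormA_ge0 //; exact: TS.
  have := xF n; rewrite /F /= innerA_sqD conjM conj_of_real -mulrA re_of_realM.
  have -> : re (of_real k (t n) * mu * (of_real k (t n) * cj mu)) =
      t n ^+ 2 * m.
    by rewrite mulrACA -mulrA !re_of_realM expr2 mulrA.
  rewrite -/(w n).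
  have := ler_wpM2l (mulr_ge0 (sqr_ge0 (t n)) m0) (dS _ (x1 n)).
  by lra.
have qTle n : q (T (x n)) <= opnormA A T ^+ 2 by exact: sq_le_opnormA.
have wle n : w n <= c + m * d.
  have := re_innerA_le (T (x n)) (S (x n)) mu; rewrite -/m -/(w n).
  have := ler_wpM2l m0 (dS _ (x1 n)); have := cT _ (x1 n).
  have := ler_norm (w n); have := mulr_ge0 m0 d0; lra.
have wge n : - (t n * (1 + m * d)) <= 2 * w n.
  rewrite -(ler_pM2l (t0 n)); have := key n; have := qTle n; lra.
have tcvg : t n @[n --> \oo] --> (0 : R) by exact: cvg_harmonic.
have xT : seminormA A (T (x n)) @[n --> \oo] --> opnormA A T.
  apply/cvg_seminormA_sq; first exact: opnormA_ge0.
  apply: (@squeeze_cvgr _ _ _ _ (fun n => opnormA A T ^+ 2 -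
      (2 * t n * (c + m * d) + t n * t n * (1 + m * d)))
    (fun=> opnormA A T ^+ 2)).
  - near=> n; rewrite qTle andbT.
    have := key n; have := ler_wpM2l (ltW (t0 n)) (wle n); lra.
  - rewrite -[X in _ --> X]subr0; apply: cvgB; first exact: cvg_cst.
    rewrite -[X in _ --> X](_ : 2 * 0 * (c + m * d) + 0 * 0 * (1 + m * d) = 0).
      apply: cvgD; apply: cvgMl; first exact: cvgMr.
      exact: cvgM.
    by ring.
  - exact: cvg_cst.
have [f f_incr [s Ws zs]] := WA_subseq x1 xT.
exists s => //.
have tf : t (f n) @[n --> \oo] --> (0 : R).
  exact: cvg_comp (increasing_seq_cvgoo f_incr) tcvg.
have lcv : - (t (f n) * (1 + m * d)) @[n --> \oo] --> - (0 * (1 + m * d)).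
  by apply: cvgN; exact: cvgMl.
rewrite mul0r oppr0 in lcv.
have rcv : 2 * w (f n) @[n --> \oo] --> 2 * re (cj mu * s).
  by apply: cvgMr; exact: cvg_scalar_re zs.
suff : 0 <= 2 * re (cj mu * s) by lra.
by apply: (ler_cvg_to lcv rcv); near=> n; exact: wge.
Unshelve. all: by end_near. Qed.

Lemma exists_norming_seq : (exists x, seminormA A x = 1) ->
  exists2 x : nat -> H, (forall n, seminormA A (x n) = 1) &
    seminormA A (T (x n)) @[n --> \oo] --> opnormA A T.
Proof.
move=> unit.
have approx n : {x | seminormA A x = 1 /\
    opnormA A T ^+ 2 - n.+1%:R^-1 < q (T x)}.
  apply: cid; have [|x x1 xT] := @opnormA_sq_approx T n.+1%:R^-1 bT unit.
    by rewrite invr_gt0.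
  by exists x.
exists (fun n => sval (approx n)) => [n|]; first by case: (svalP (approx n)).
apply/cvg_seminormA_sq; first exact: opnormA_ge0.
apply: (@squeeze_cvgr _ _ _ _ (fun n => opnormA A T ^+ 2 - n.+1%:R^-1)
  (fun=> opnormA A T ^+ 2)).
- near=> n; have [x1 xT] := svalP (approx n).
  by rewrite (ltW xT) sq_le_opnormA.
- rewrite -[X in _ --> X]subr0; apply: cvgB; first exact: cvg_cst.
  exact: cvg_harmonic.
- exact: cvg_cst.
Unshelve. all: by end_near. Qed.

(** Coefficients are conjugated because S x is in the antilinear slot; the
    T-part contributes ||T x_n||^2, which tends to N^2. *)
Lemma WA_comb (a b s : K) : WA A T S s ->
  WA A T (a \*: S \+ b \*: T) (cj a * s + cj b * of_real k (opnormA A T ^+ 2)).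
Proof.
move=> [x [x1 xT xS]]; exists x; split => //.
rewrite (_ : (fun n => _) = fun n => cj a * '[T (x n), S (x n)] +
    cj b * of_real k (q (T (x n)))); last first.
  by apply/funext => n /=; rewrite innerADr !innerAZr -innerAxx_real.
apply: cvgD; apply: cvgMr => //.
apply: cvg_of_real.
by apply/cvg_seminormA_sq => //; exact: opnormA_ge0.
Qed.

(** The half-plane Re ((- s)^* z) >= 0 meets {s} only if s = 0. *)
Lemma WA0_of_BJorthA (s : K) : (exists x, seminormA A x = 1) ->
  WA A T S = [set s] -> BJorthA A T S -> WA A T S 0.
Proof.
move=> unit Ws TS; have [s' ] := WA_half_plane (- s) unit TS.
rewrite Ws => -> ; rewrite rmorphN mulNr reN mulrC oppr_ge0 => le0.
suff /re_mul_conj_eq0 -> : re (s * cj s) = 0 by [].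
by apply/eqP; rewrite eq_le le0 re_mul_conj_ge0.
Qed.

End Norming.

(** The perturbation T - c^-1 (c T) vanishes. *)
Lemma not_BJorthA_scale (T : {linear H -> H}) (c : K) (F : H -> H) :
  semibounded T -> opnormA A T != 0 -> c != 0 -> (forall x, F x = c *: T x) ->
  ~ BJorthA A T F.
Proof.
move=> bT T0 c0 FE /(_ (- c^-1)).
have [x0 x01] := unit_of_opnormA_neq0 T0.
have zero x : seminormA A ((T \+ (- c^-1 \*: F)) x) = 0.
  rewrite /= FE scalerA mulNr mulVf // scaleN1r subrr /seminormA.
  by rewrite -(scale0r (0 : H)) innerAZl mul0r re0 sqrtr0.
move=> TF; move/eqP: T0; apply; apply/eqP; rewrite eq_le opnormA_ge0 // andbT.
apply: le_trans TF _; apply: ge_sup; first by eexists; exists x0.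
by move=> _ [x x1 <-]; rewrite zero.
Qed.

Lemma bounded_op_comb (S T : {linear H -> H}) (a b : K) :
  bounded_op S -> bounded_op T -> bounded_op (a \*: S \+ b \*: T).
Proof.
move=> [c cS] [d dT]; exists (`|a| * c + `|b| * d) => x /=.
apply: le_trans (ler_normD _ _) _; rewrite !normrZ mulrDl -!mulrA.
by apply: lerD; rewrite ler_wpM2l.
Qed.

Lemma bounded_opA_comb (S T : {linear H -> H}) (a b : K) :
  bounded_opA A S -> bounded_opA A T -> bounded_opA A (a \*: S \+ b \*: T).
Proof.
move=> bS bT; apply: bounded_opA_of_semibounded.
  by apply: bounded_op_comb; [case: bS | case: bT].
by apply: semiboundedD; [apply: semiboundedZ|]; exact: bounded_opA_semibounded.
Qed.

(** * Smoothness and uniqueness of the limit value *)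

(** Subtracting from S the right multiple of T moves a given element of
    [WA A T S] to 0; two such elements would then, by smoothness, make T
    orthogonal to a nonzero multiple of itself. *)
Lemma smoothA_WA_unique (T S : {linear H -> H}) (s1 s2 : K) :
  smoothA A T -> bounded_opA A S -> WA A T S s1 -> WA A T S s2 -> s1 = s2.
Proof.
move=> [bT T0 smT] bS W1 W2; apply/eqP; rewrite -subr_eq0.
apply/negPn/negP => s12.
have bT' := bounded_opA_semibounded bT.
have bS' := bounded_opA_semibounded bS.
pose r := of_real k ((opnormA A T ^+ 2)^-1).
have rN : r * of_real k (opnormA A T ^+ 2) = 1.
  by rewrite -of_realM mulVf ?of_real1 // sqrf_eq0.
(* [a] will be 1 for [s1] and - 1 for [s2], so that [S] cancels in the sum. *)
have orth (a s : K) : WA A T S s ->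
    BJorthA A T (a \*: S \+ cj (- (cj a * s * r)) \*: T).
  move=> Ws; apply: BJorthA_of_WA0 => //.
    exact/bounded_opA_semibounded/bounded_opA_comb.
  have := WA_comb bT' a (cj (- (cj a * s * r))) Ws.
  by rewrite conjK mulNr -(mulrA _ r) rN mulr1 subrr.
have := smT _ _ (bounded_opA_comb 1 _ bS bT) (bounded_opA_comb (-1) _ bS bT)
   (orth 1 _ W1) (orth (-1) _ W2).
apply: (@not_BJorthA_scale T (cj ((s2 - s1) * r))) => //.
  have r0 : r != 0 by rewrite of_real_eq0 invr_eq0 sqrf_eq0.
  by rewrite fmorph_eq0 mulf_neq0 // -opprB oppr_eq0.
move=> x /=.
have cj1 : cj (-1) = -1 by rewrite rmorphN1.
rewrite scale1r scaleN1r addrACA subrr add0r -scalerDl -rmorphD /=.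
by rewrite cj1 rmorph1 mul1r mulN1r mulNr opprK addrC mulrBl.
Qed.

End SemiInnerProduct.

Theorem theorem2p5 (R : realType) (k : scalar_kind) (H : hilbertType R k)
    (A T : {linear H -> H}) :
  bounded_op A -> positive_op A -> (exists x, A x != 0) ->
  bounded_opA A T -> opnormA A T != 0 ->
  smoothA A T <->
  (forall S : {linear H -> H}, bounded_opA A S ->
     exists sigma : scalars R k, WA A T S = [set sigma]).
Proof.
move=> _ posA _ bT T0.
have bT' := bounded_opA_semibounded posA bT.
have unit := unit_of_opnormA_neq0 T0.
split=> [smT S bS|W1].
  have bS' := bounded_opA_semibounded posA bS.
  have [x x1 xT] := exists_norming_seq posA bT' unit.
  have [f _ [s Ws _]] := WA_subseq posA bT' bS' x1 xT.
  exists s; apply/seteqP; split=> [s' Ws'|_ ->//].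
  exact: smoothA_WA_unique smT bS Ws' Ws.
split=> // S1 S2 bS1 bS2 TS1 TS2.
have bS1' := bounded_opA_semibounded posA bS1.
have bS2' := bounded_opA_semibounded posA bS2.
have [s1 W1S1] := W1 _ bS1; have [s2 W1S2] := W1 _ bS2.
have [x [x1 xT xS1]] := WA0_of_BJorthA posA bT' bS1' unit W1S1 TS1.
(* One sequence must serve both operators: refine the one chosen for [S1]. *)
have [f f_incr [s Ws xS2]] := WA_subseq posA bT' bS2' x1 xT.
have s0 : s = 0.
  move: (WA0_of_BJorthA posA bT' bS2' unit W1S2 TS2) Ws.
  by rewrite W1S2 => -> ->.
have f_oo := increasing_seq_cvgoo f_incr.
apply: (@BJorthA_of_WA0 _ _ _ _ posA T (S1 \+ S2)) => //.
  have := semiboundedD posA 1 bS1' bS2'.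
  rewrite (_ : _ \+ (1 \*: _) = S1 \+ S2) //.
  by apply/funext => y /=; rewrite scale1r.
exists (x \o f); split; first by move=> n; exact: x1 (f n).
  exact: (cvg_comp _ _ f_oo xT).
rewrite (_ : (fun n => _) = fun n => innerA A (T (x (f n))) (S1 (x (f n))) +
    innerA A (T (x (f n))) (S2 (x (f n)))); last first.
  by apply/funext => n /=; rewrite innerADr.
rewrite -[0]addr0; apply: cvgD; last by rewrite -s0.
exact: (cvg_comp _ _ f_oo xS1).
Qed.
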